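(* Let $(\mathbf{x}_1,\mathbf{t}_1),(\mathbf{x}_2,\mathbf{t}_2),\dots$ be i.i.d. pairs drawn from a joint distribution $p(\mathbf{x},\mathbf{t})$ with marginals $p(\mathbf{x})$ and $p(\mathbf{t})$. Let $\mathbf{f}_x,\mathbf{f}_t$ be measurable encoders taking values in a compact set $K\subset\mathbb{R}^D$, let $d:K\times K\to\mathbb{R}$ be continuous, and fix $\tau>0$. Let $\mathcal{L}_N$ denote the multimodal contrastive loss computed on the first $N$ pairs. Then, almost surely, $$\lim_{N\to\infty}\big(\mathcal{L}_N-2\log N\big)=2\,\mathbb{E}_{(\mathbf{x},\mathbf{t})\sim p(\mathbf{x},\mathbf{t})}\big[d(\mathbf{f}_x(\mathbf{x}),\mathbf{f}_t(\mathbf{t}))/\tau\big]+\mathbb{E}_{\mathbf{x}\sim p(\mathbf{x})}\Big[\log\mathbb{E}_{\mathbf{t}\sim p(\mathbf{t})}\big[e^{-d(\mathbf{f}_x(\mathbf{x}),\mathbf{f}_t(\mathbf{t}))/\tau}\big]\Big]+\mathbb{E}_{\mathbf{t}\sim p(\mathbf{t})}\Big[\log\mathbb{E}_{\mathbf{x}\sim p(\mathbf{x})}\big[e^{-d(\mathbf{f}_x(\mathbf{x}),\mathbf{f}_t(\mathbf{t}))/\tau}\big]\Big],$$ where in the inner expectations $\mathbf{x}$ and $\mathbf{t}$ are drawn independently from their marginals.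
   Context: The multimodal contrastive loss on $N$ pairs $(\mathbf{x}_i,\mathbf{t}_i)_{i=1}^N$ with encoders $\mathbf{f}_x,\mathbf{f}_t$, ''distance'' $d$ and temperature $\tau>0$ is $$\mathcal{L}_N=-\frac1N\sum_{i=1}^N\log\frac{e^{-d(\mathbf{f}_x(\mathbf{x}_i),\mathbf{f}_t(\mathbf{t}_i))/\tau}}{\sum_{j=1}^N e^{-d(\mathbf{f}_x(\mathbf{x}_i),\mathbf{f}_t(\mathbf{t}_j))/\tau}}-\frac1N\sum_{i=1}^N\log\frac{e^{-d(\mathbf{f}_x(\mathbf{x}_i),\mathbf{f}_t(\mathbf{t}_i))/\tau}}{\sum_{j=1}^N e^{-d(\mathbf{f}_x(\mathbf{x}_j),\mathbf{f}_t(\mathbf{t}_i))/\tau}}.$$ *)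

(* Defs.v *)
From HB Require Import structures.
From mathcomp Require Import all_boot all_order all_algebra.
From mathcomp Require Import all_classical all_reals all_analysis.
Set Implicit Arguments. Unset Strict Implicit. Unset Printing Implicit Defensive.
Import Order.TTheory GRing.Theory Num.Theory.
Import numFieldNormedType.Exports.
Local Open Scope classical_set_scope.
Local Open Scope ring_scope.

Definition mutually_independent {d dS : measure_display} {Omega : measurableType d}
  {S : measurableType dS} {R : realType} (P : probability Omega R)
  (Z : nat -> Omega -> S) : Prop :=
  forall (s : seq nat) (A : nat -> set S), uniq s ->
    (forall i, i \in s -> measurable (A i)) ->
    P (\big[setI/setT]_(i <- s) (Z i @^-1` A i)) =
    (\prod_(i <- s) P (Z i @^-1` A i))%E.

Definition has_law {d dS : measure_display} {Omega : measurableType d}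
  {S : measurableType dS} {R : realType} (P : probability Omega R)
  (Y : Omega -> S) (p : probability S R) : Prop :=
  forall A : set S, measurable A -> P (Y @^-1` A) = p A.

(* Measurability of a map into R^D = 'rV[R]_D (Borel = product sigma-algebra):
   every coordinate is measurable. *)
Definition measurable_vec {dX : measure_display} {X : measurableType dX}
  {R : realType} {D : nat} (f : X -> 'rV[R]_D) : Prop :=
  forall j : 'I_D, measurable_fun setT (fun x => f x ord0 j).

(* The multimodal contrastive loss on N pairs (u_i, v_i)_{i<N},
   with u_i = f_x(x_i), v_i = f_t(t_i). *)
Definition contrastive_loss {R : realType} {D : nat}
  (d : 'rV[R]_D -> 'rV[R]_D -> R) (tau : R) (N : nat)
  (u v : nat -> 'rV[R]_D) : R :=
  let s i j := expR (- d (u i) (v j) / tau) in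
  - N%:R^-1 * \sum_(i < N) ln (s i i / \sum_(j < N) s i j)
  - N%:R^-1 * \sum_(i < N) ln (s i i / \sum_(j < N) s j i).

(* Main.v *)
(* The crux is a strong law for the log-partition terms, whose inner averages
   N^-1 sum_j k(u, v_j) depend on the same sample as the outer one.  The kernel
   k = exp(-d/tau) is uniformly continuous on K x K, so a countable union of
   finite nets of K reduces the convergence of the inner average to
   G(u) = E[k(u, v)], uniformly in u in K, to countably many applications of the
   strong law for bounded variables.  Since k is bounded below by a positive
   constant, ln is Lipschitz on the relevant range, so each inner average may be
   replaced by G(u_i), and the strong law applies once more to ln G(u_i).

   The strong law for bounded variables uses only pairwise independence: the
   squared sample means along n = k^2 have summable expectations, and between
   consecutive squares the mean varies negligibly. *)
Require Import Defs.
From HB Require Import structures.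
From mathcomp Require Import all_boot all_order all_algebra.
From mathcomp Require Import all_classical all_reals all_analysis.
From mathcomp Require Import measurable_realfun zify ring lra.
Import Order.TTheory GRing.Theory Num.Theory.
Import numFieldNormedType.Exports.
Local Open Scope classical_set_scope.
Local Open Scope ring_scope.

(** * Bounded measurable functions and their integrals *)

Section BoundedMeasurable.
Context {dS : measure_display} {S : measurableType dS} {R : realType}.
Implicit Types f g : S -> R.

(** The class is closed under sums and products, and its members are integrable for every
    probability measure, so each integrability condition below reduces to closure properties. *)
Definition bounded_measurable f :=
  measurable_fun setT f /\ exists M : R, forall x, `|f x| <= M.

Lemma bounded_measurable_cst c : bounded_measurable (fun=> c).
Proof. by split; [exact: measurable_cst | exists `|c|]. Qed.

Lemma bounded_measurableD f g : bounded_measurable f -> bounded_measurable g ->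
  bounded_measurable (fun x => f x + g x).
Proof.
move=> [mf [A fA]] [mg [B gB]]; split; first exact: measurable_funD.
by exists (A + B) => x; rewrite (le_trans (ler_normD _ _)) ?lerD.
Qed.

Lemma bounded_measurableM f g : bounded_measurable f -> bounded_measurable g ->
  bounded_measurable (fun x => f x * g x).
Proof.
move=> [mf [A fA]] [mg [B gB]]; split; first exact: measurable_funM.
by exists (A * B) => x; rewrite normrM ler_pM.
Qed.

Lemma bounded_measurable_sum (I : Type) (s : seq I) (h : I -> S -> R) :
  (forall i, bounded_measurable (h i)) ->
  bounded_measurable (fun x => \sum_(i <- s) h i x).
Proof.
move=> hb; elim: s => [|i s IH].
  by under eq_fun do rewrite big_nil; exact: bounded_measurable_cst.
by under eq_fun do rewrite big_cons; exact: bounded_measurableD.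
Qed.

Variable p : probability S R.

Lemma bounded_measurable_integrable f : bounded_measurable f ->
  p.-integrable setT (EFin \o f).
Proof.
move=> [mf [M fM]]; apply: measurable_bounded_integrable => //.
  by rewrite /= -ge0_fin_numE // fin_num_measure.
exists M; split; first exact: num_real.
by move=> y My x _ /=; apply: (le_trans (fM x)); exact: ltW.
Qed.

Lemma Rintegral_sum (I : Type) (s : seq I) (h : I -> S -> R) :
  (forall i, bounded_measurable (h i)) ->
  \int[p]_x (\sum_(i <- s) h i x) = \sum_(i <- s) \int[p]_x h i x.
Proof.
move=> hb; elim: s => [|i s IH].
  under eq_Rintegral do rewrite big_nil.
  by rewrite Rintegral_cst // mul0r big_nil.
under eq_Rintegral do rewrite big_cons.
rewrite RintegralD ?IH ?big_cons //; apply: bounded_measurable_integrable => //.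
exact: bounded_measurable_sum.
Qed.

Lemma Rintegral_prob_cst c : \int[p]_(_ in setT) c = c.
Proof.
rewrite Rintegral_cst //.
by have /= -> := @probability_setT _ _ _ p; rewrite mulr1.
Qed.

Lemma EFin_Rintegral f : bounded_measurable f ->
  (\int[p]_x f x)%:E = (\int[p]_x (f x)%:E)%E.
Proof.
move=> bf; rewrite /Rintegral fineK //.
exact: (integrable_fin_num measurableT (bounded_measurable_integrable _ bf)).
Qed.

End BoundedMeasurable.

Lemma bounded_measurable_comp {dO dS : measure_display}
    {O : measurableType dO} {S : measurableType dS} {R : realType}
    (z : O -> S) (f : S -> R) :
  measurable_fun setT z -> bounded_measurable f ->
  bounded_measurable (f \o z).
Proof.
move=> mz [mf [M fM]]; split; first exact: measurableT_comp.
by exists M => x; exact: fM.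
Qed.

(** * Joint law of two distinct samples *)

Section IndependentPairs.
Context {dO dS : measure_display} {O : measurableType dO}
  {S : measurableType dS} {R : realType}.
Variables (P : probability O R) (p : probability S R) (Z : nat -> O -> S).
Hypothesis mZ : forall i, measurable_fun setT (Z i).
Hypothesis lawZ : forall i, has_law P (Z i) p.
Hypothesis indZ : mutually_independent P Z.

(** Independence gives the equality on measurable rectangles, and a measure that agrees with the
    product on rectangles is the product measure. *)
Lemma indep_pair_law i j (C : set (S * S)) : i != j -> measurable C ->
  P ((fun w => (Z i w, Z j w)) @^-1` C) = (p \x p)%E C.
Proof.
move=> ij mC.
have mZij : measurable_fun setT (fun w => (Z i w, Z j w)).
  exact: measurable_fun_pair.
apply/esym.
apply: (@product_measure_unique _ _ _ _ _ p p (pushforward P (fun w => (Z i w, Z j w)))) => //.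
move=> A B mA mB.
(* [indZ] expects a set for every index; [j] receives [B] because [i != j]. *)
pose F k := if k == i then A else B.
have := indZ [:: i; j] F.
rewrite /= inE ij => /(_ isT).
rewrite !big_cons !big_nil setIT mule1 /F eqxx eq_sym (negbTE ij) !lawZ //.
move=> <- //.
by move=> k; rewrite !inE => /orP[]/eqP->; rewrite ?eqxx // eq_sym (negbTE ij).
Qed.

(** Change of variables moves the integral to the product measure, where Fubini separates the
    factors. *)
Lemma Rintegral_indep_pair i j (f g : S -> R) : i != j ->
  bounded_measurable f -> bounded_measurable g ->
  \int[P]_w (f (Z i w) * g (Z j w)) = (\int[p]_x f x) * (\int[p]_x g x).
Proof.
move=> ij bf bg.
have mZij : measurable_fun setT (fun w => (Z i w, Z j w)).
  exact: measurable_fun_pair.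
pose h (q : S * S) := f q.1 * g q.2.
have bh : bounded_measurable h.
  by apply: bounded_measurableM; [exact: (bounded_measurable_comp fst)|
    exact: (bounded_measurable_comp snd)].
have ih : (p \x p)%E.-integrable setT (EFin \o h).
  exact: bounded_measurable_integrable.
apply: EFin_inj.
rewrite EFinM !EFin_Rintegral //;
  last exact: (bounded_measurable_comp _ h mZij bh).
transitivity (\int[pushforward P (fun w => (Z i w, Z j w))]_q (h q)%:E)%E.
  rewrite integral_pushforward //.
  - by apply/measurable_EFinP; case: bh.
  - rewrite preimage_setT.
    exact/(bounded_measurable_integrable P)/(bounded_measurable_comp _ _ mZij bh).
transitivity (\int[p \x p]_q (h q)%:E)%E.
  by apply: eq_measure_integral => A mA _; exact: indep_pair_law.
rewrite -integral12_prod_meas1 //.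
rewrite /fubini_F /=.
have Eg x : (\int[p]_y (h (x, y))%:E = (f x)%:E * (\int[p]_y (g y)%:E))%E.
  rewrite -integralZl //; exact: bounded_measurable_integrable.
under eq_integral do rewrite Eg.
rewrite -EFin_Rintegral // integralZr //; exact: bounded_measurable_integrable.
Qed.

End IndependentPairs.

(** * Sample means and interpolation between squares *)

Definition sample_mean {R : realType} (y : nat -> R) (n : nat) : R :=
  n%:R^-1 * \sum_(i < n) y i.

Lemma sqrt_nat_exists n : exists k : nat, (k * k <= n < k.+1 * k.+1)%N.
Proof.
elim: n => [|n [k /andP[kn nk]]]; first by exists 0.
have [lt|ge] := ltnP n.+1 (k.+1 * k.+1); first by exists k; rewrite lt andbT; lia.
by exists k.+1; rewrite ge; lia.
Qed.

(* Between consecutive squares k^2 <= n < (k+1)^2 the sum moves by at most 2kM,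
   which is negligible against n >= k^2. *)
Lemma sample_mean_cvg_squares {R : realType} (y : nat -> R) (M : R) :
  (forall i, `|y i| <= M) ->
  sample_mean y (k.+1 * k.+1)%N @[k --> \oo] --> (0 : R) ->
  sample_mean y @ \oo --> (0 : R).
Proof.
move=> yM sq; apply/cvgrPdist_le => e e0.
have M0 : 0 <= M by apply: le_trans (yM 0).
have e2 : 0 < e / 2 by rewrite divr_gt0.
move/cvgrPdist_le : sq => /(_ _ e2)[K1 _ HK1].
(* For a root [k >= K2], the increment bound [2 * M * k] is at most [e / 2 * k * k]. *)
have [K2 HK2] : exists K2 : nat, 2 * M / (e / 2) <= K2%:R.
  exists (Num.bound (2 * M / (e / 2))).
  rewrite ltW // archi_boundP // divr_ge0 // ?mulr_ge0 //; exact: ltW.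
exists ((K1 + K2).+1 * (K1 + K2).+1)%N => // n /= nK.
have [k /andP[kn nk]] := sqrt_nat_exists n.
have kK : (K1 + K2 < k)%N by nia.
(* The root becomes [k.+1], matching the indexing of the squares in the hypothesis. *)
case: k kn nk kK => // k kn nk kK.
have k0 : (0 : R) < k.+1%:R by rewrite ltr0n.
have n0 : (0 : R) < n%:R by rewrite ltr0n; lia.
rewrite sub0r normrN /sample_mean.
have := HK1 k; rewrite /= sub0r normrN /sample_mean => /(_ ltac:(lia)) HS.
have HT : `|\sum_(k.+1 * k.+1 <= i < n) y i| <= 2 * M * k.+1%:R.
  rewrite (le_trans (ler_norm_sum _ _ _)) //.
  rewrite (le_trans (ler_sum _ (fun i _ => yM i))) //.
  rewrite sumr_const_nat -[_ *+ (n - _)]mulr_natl [leRHS]mulrAC ler_wpM2r //.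
  by rewrite -natrM ler_nat; lia.
rewrite -(big_mkord xpredT y) (big_cat_nat (leq0n _) kn) //= mulrDr.
rewrite (le_trans (ler_normD _ _)) // [leRHS](splitr e) lerD //.
  rewrite -(big_mkord xpredT y) in HS.
  apply: le_trans HS; rewrite !normrM ler_wpM2r // !ger0_norm ?invr_ge0 //.
  by rewrite lef_pV2 ?posrE ?ler_nat // ltr0n; lia.
rewrite normrM ger0_norm ?invr_ge0 // mulrC ler_pdivrMr //.
apply: (le_trans HT).
apply: (@le_trans _ _ (e / 2 * k.+1%:R * k.+1%:R)); last first.
  by rewrite -[leLHS]mulrA ler_wpM2l -?natrM ?ler_nat //; exact: ltW.
rewrite ler_wpM2r ?ler0n // -ler_pdivrMl // mulrC.
by rewrite (le_trans HK2) // ler_nat; lia.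
Qed.

(** * Strong law of large numbers for bounded functions *)

Section StrongLaw.
Context {dO dS : measure_display} {O : measurableType dO}
  {S : measurableType dS} {R : realType}.
Variables (P : probability O R) (p : probability S R) (Z : nat -> O -> S).
Hypothesis mZ : forall i, measurable_fun setT (Z i).
Hypothesis lawZ : forall i, has_law P (Z i) p.
Hypothesis indZ : mutually_independent P Z.

Let bounded_measurable_coord (f : S -> R) i : bounded_measurable f ->
  bounded_measurable (fun w => f (Z i w)).
Proof. exact: bounded_measurable_comp. Qed.

(** In the expanded square the off-diagonal terms integrate to zero by pairwise independence and
    centering; each of the [n] diagonal terms contributes at most [M ^+ 2]. *)
Lemma second_moment_sum (f : S -> R) (M : R) n : measurable_fun setT f ->
  (forall x, `|f x| <= M) -> \int[p]_x f x = 0 ->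
  \int[P]_w ((\sum_(i < n) f (Z i w)) ^+ 2) <= n%:R * M ^+ 2.
Proof.
move=> mf fM f0.
have bf : bounded_measurable f by split => //; exists M.
have bff i j : bounded_measurable (fun w => f (Z i w) * f (Z j w)).
  by apply: bounded_measurableM; exact: bounded_measurable_coord.
under eq_Rintegral do rewrite expr2 big_distrlr /=.
rewrite Rintegral_sum; last by move=> i; exact: bounded_measurable_sum.
rewrite mulr_natl -[in leRHS](card_ord n) -sumr_const ler_sum // => i _.
rewrite Rintegral_sum // (bigD1 i) //= big1 ?addr0; last first.
  move=> j ji; have ij : (i : nat) != j by rewrite eq_sym.
  by rewrite (Rintegral_indep_pair _ _ _ mZ lawZ indZ _ _ _ _ ij) // f0 mul0r.
rewrite -[leRHS](Rintegral_prob_cst P).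
apply: le_Rintegral => //; first exact: bounded_measurable_integrable.
  exact/bounded_measurable_integrable/bounded_measurable_cst.
move=> w _; rewrite -expr2 -(ger0_norm (sqr_ge0 _)) normrX lerXn2r ?nnegrE //.
exact: le_trans (fM (Z i w)).
Qed.

(** The series of squared means along the squares has finite expectation, so it is almost surely
    finite and its terms tend to zero; interpolation then covers all indices. *)
Lemma slln_centered (f : S -> R) (M : R) : measurable_fun setT f ->
  (forall x, `|f x| <= M) -> \int[p]_x f x = 0 ->
  {ae P, forall w, sample_mean (fun i => f (Z i w)) @ \oo --> (0 : R)}.
Proof.
move=> mf fM f0.
have bf : bounded_measurable f by split => //; exists M.
pose a k w := (sample_mean (fun i => f (Z i w)) (k.+1 * k.+1)%N) ^+ 2.
have bS n : bounded_measurable (fun w => \sum_(i < n) f (Z i w)).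
  by apply: bounded_measurable_sum => i; exact: bounded_measurable_coord.
have ba k : bounded_measurable (a k).
  rewrite /a /sample_mean; under eq_fun do rewrite expr2.
  by apply: bounded_measurableM; apply: bounded_measurableM => //;
    exact: bounded_measurable_cst.
have a0 k w : 0 <= a k w by exact: sqr_ge0.
(* The second moment bound gives [M ^+ 2 / (k.+1 * k.+1)%:R]; since [k.+2 <= 2 * k.+1], this lies
   below a telescoping term. *)
have Ea k : \int[P]_w a k w <= 2 * M ^+ 2 * (k.+1%:R^-1 - k.+2%:R^-1).
  rewrite /a /sample_mean.
  under eq_Rintegral do rewrite exprMn.
  rewrite RintegralZl //; last first.
    apply: bounded_measurable_integrable; under eq_fun do rewrite expr2.
    exact: bounded_measurableM.
  have := second_moment_sum _ _ (k.+1 * k.+1)%N mf fM f0.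
  set I := Rintegral _ _ _ => HI.
  have k1 : (0 : R) < k.+1%:R by rewrite ltr0n.
  have k2 : (0 : R) < k.+2%:R by rewrite ltr0n.
  apply: (@le_trans _ _ (M ^+ 2 / (k.+1 * k.+1)%:R)).
    rewrite (le_trans (ler_wpM2l (sqr_ge0 _) HI)) // natrM.
    by rewrite le_eqVlt; apply/orP; left; apply/eqP; field; rewrite gt_eqF.
  rewrite -mulrA mulrCA ler_wpM2l ?sqr_ge0 // natrM.
  have -> : 2 * (k.+1%:R^-1 - k.+2%:R^-1) = 2 / (k.+1%:R * k.+2%:R) :> R.
    rewrite -[k.+2%:R]natr1 in k2 *; move: k1 k2.
    by move: (k.+1%:R : R) => x x0 x1; field; rewrite !gt_eqF.
  rewrite ler_pdivlMr ?mulr_gt0 // mulrC ler_pdivrMr ?mulr_gt0 //.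
  by rewrite -!natrM ler_nat; lia.
(* Nonnegativity allows the exchange of sum and integral, and the partial sums telescope. *)
have Easum : (\int[P]_w (\sum_(k <oo) (a k w)%:E) <= (2 * M ^+ 2)%:E)%E.
  rewrite integral_nneseries //; last 2 first.
  - by move=> k; apply/measurable_EFinP; case: (ba k).
  - by move=> k w _; rewrite lee_fin.
  apply: lime_le.
    by apply: is_cvg_nneseries => k _ _; apply: integral_ge0 => w _; rewrite lee_fin.
  apply: nearW => n /=.
  under eq_bigr do rewrite -EFin_Rintegral //.
  rewrite sumEFin lee_fin.
  rewrite (le_trans (ler_sum _ (fun k _ => Ea k))) // -mulr_sumr.
  rewrite ler_piMr ?(mulr_ge0 _ (sqr_ge0 _)) //.
  under eq_bigr do rewrite -opprB.
  rewrite sumrN (@telescope_sumr _ 0 n (fun k => k.+1%:R^-1)) // opprB invr1.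
  by rewrite lerBlDr lerDl invr_ge0.
have iA : P.-integrable setT (fun w => \sum_(k <oo) (a k w)%:E)%E.
  apply/integrableP; split.
    apply: ge0_emeasurable_sum => [k w _ _|k _]; first by rewrite lee_fin.
    by apply/measurable_EFinP; case: (ba k).
  rewrite (eq_integral (fun w => \sum_(k <oo) (a k w)%:E)%E).
    exact: le_lt_trans Easum (ltry _).
  by move=> w _; rewrite gee0_abs // nneseries_ge0 // => k _ _; rewrite lee_fin.
have := integrable_ae measurableT iA.
apply: filterS => w /(_ I) fin.
apply: (@sample_mean_cvg_squares _ _ M) => //.
have acv : a k w @[k --> \oo] --> (0 : R).
  apply/cvg_series_cvg_0/nnseries_is_cvg => //.
  by rewrite -ge0_fin_numE // nneseries_ge0 // => k _ _; rewrite lee_fin.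
apply/norm_cvg0P/cvgrPdist_le => e e0.
move/cvgrPdist_le : acv => /(_ _ (exprn_gt0 2 e0))[K _ HK].
exists K => // k Kk; have := HK k Kk.
rewrite /= !sub0r !normrN /a normrX normr_id.
by rewrite ler_pXn2r // nnegrE // ltW.
Qed.

Theorem strong_law_bounded (f : S -> R) : bounded_measurable f ->
  {ae P, forall w, sample_mean (fun i => f (Z i w)) @ \oo --> \int[p]_x f x}.
Proof.
move=> bf; set mu := \int[p]_x f x.
have [mg [M gM]] : bounded_measurable (fun x => f x + - mu).
  by apply: bounded_measurableD => //; exact: bounded_measurable_cst.
have g0 : \int[p]_x (f x + - mu) = 0.
  rewrite RintegralD ?Rintegral_prob_cst ?subrr //;
    apply: bounded_measurable_integrable => //; exact: bounded_measurable_cst.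
apply: filterS (slln_centered _ _ mg gM g0) => w.
move=> /cvgrPdist_le cv; apply/cvgrPdist_le => e e0.
have [N _ HN] := cv e e0.
(* The threshold [N.+1] forces [n] to be nonzero, so that the mean of the constant [- mu] is
   [- mu]. *)
exists N.+1 => // n /= Nn; have := HN n (ltnW Nn).
rewrite /sample_mean /= sub0r normrN big_split /= sumr_const card_ord mulrDr.
have n0 : n%:R != 0 :> R by rewrite pnatr_eq0; lia.
by rewrite -[(- mu) *+ n]mulr_natl mulKf // distrC.
Qed.

End StrongLaw.

(** * Finite nets, uniform continuity and measurability on compact sets *)

Definition unif_continuous_on {R : realType} {V : pseudoMetricType R}
    (C : set V) (g : V -> R) : Prop :=
  forall e : R, 0 < e -> exists2 r : R, 0 < r &
    forall q q', C q -> C q' -> ball q r q' -> `|g q - g q'| <= e.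

Lemma compact_finite_net {R : realType} {V : pseudoMetricType R} (C : set V)
    (r : R) :
  compact C -> 0 < r ->
  exists2 s : seq V, {in s, forall c, C c} &
    forall q, C q -> exists2 c, c \in s & ball c r q.
Proof.
move=> /compact_near_coveringP cC r0.
(* the filter of the finite subsets of C, directed by inclusion *)
pose F : set_system (seq V) := [set A : set (seq V) |
  exists2 s0 : seq V, {in s0, forall c, C c} &
  forall s : seq V, {in s, forall c, C c} -> {subset s0 <= s} -> A s].
have FF : Filter F.
  split; first by exists [::].
  - move=> A B [s sC sA] [t tC tB]; exists (s ++ t).
      by move=> c; rewrite mem_cat => /orP[/sC|/tC].
    move=> q qC sub; split; [apply: sA | apply: tB] => // c cs; apply: sub;
      by rewrite mem_cat cs ?orbT.
  - by move=> A B AB [s sC sA]; exists s => // t tC /(sA _ tC)/AB.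
(* Near [q], any finite set containing [q] already covers; compactness then yields a single finite
   set covering all of [C]. *)
have [q Cq|s sC] := cC _ F (fun (s : seq V) q => exists2 c, c \in s & ball c r q) FF.
  exists (ball q r, [set s : seq V | q \in s]); rewrite /=; first split.
  - exact: nbhsx_ballx.
  - by exists [:: q] => [c|s _]; [rewrite inE => /eqP->|apply; rewrite inE].
  by move=> [x s] /= [bx qs]; exists q.
by move=> /(_ s sC (fun _ => id)) H; exists s.
Qed.

(** The Heine-Cantor theorem: the covering form of compactness, applied to radii tending to zero
    from the right, makes the local radius uniform. *)
Lemma compact_unif_continuous {R : realType} {V : pseudoMetricType R}
    (C : set V) (g : V -> R) :
  compact C -> {within C, continuous g} -> unif_continuous_on C g.
Proof.
move=> cC cg e e0.
move/compact_near_coveringP/near_covering_withinP : cC => cC.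
have : \forall r \near (0 : R)^'+, C `<=`
    [set q | forall q', C q' -> ball q r q' -> `|g q - g q'| <= e].
  apply: cC => c Cc.
  move/subspace_continuousP : cg => /(_ c Cc)/cvgrPdist_lt.
  move=> /(_ _ (divr_gt0 e0 (ltr0Sn _ 1)))/nbhs_ballP[d /= d0 Hd].
  (* Halving [d] keeps both [q] and a point [q'] within [r] of it inside the ball of radius [d]
     around [c]. *)
  exists (ball c (d / 2), [set r | r < d / 2]); rewrite /=; first split.
  - by apply/nbhs_ballP; exists (d / 2) => //=; rewrite divr_gt0.
  - by apply: nbhs_right_lt; rewrite divr_gt0.
  move=> [q r] /= [cq rd] Cq q' Cq' qq'.
  have d2d : d / 2 <= d by rewrite ler_pdivrMr // ler_peMr // ?ltW //; lra.
  have A1 := Hd q (le_ball d2d cq) Cq.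
  have A2 : `|g c - g q'| < e / 2.
    apply: Hd => //; rewrite [d]splitr; apply: ball_triangle cq _.
    by apply: le_ball qq'; exact: ltW.
  rewrite -(subrK (g c) (g q)) -addrA (le_trans (ler_normD _ _)) //.
  by rewrite [leRHS](splitr e) lerD // ltW // distrC.
move=> near_r.
near (0 : R)^'+ => r.
exists r; first by near: r; exact: nbhs_right_gt.
have sub : C `<=` [set q | forall q', C q' -> ball q r q' -> `|g q - g q'| <= e].
  by near: r.
by move=> q q' Cq Cq'; exact: sub.
Unshelve. all: end_near. Qed.

(* [{g \o F > a}] is the union over n of the preimages of the balls B of a
   1/(n+1)-oscillation net whose centre satisfies [g > a + 1/(n+1)]. *)
Lemma measurable_unif_continuous_comp {R : realType} {V : pseudoMetricType R}
    {dO : measure_display} {O : measurableType dO} (C : set V) (g : V -> R)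
    (F : O -> V) :
  compact C -> unif_continuous_on C g -> (forall x, C (F x)) ->
  (forall c r, measurable (F @^-1` ball c r)) ->
  measurable_fun setT (g \o F).
Proof.
move=> cC ug CF mF.
have H n : exists rs : R * seq V, [/\ 0 < rs.1,
    forall q q', C q -> C q' -> ball q rs.1 q' -> `|g q - g q'| <= n.+1%:R^-1,
    {in rs.2, forall c, C c} &
    forall q, C q -> exists2 c, c \in rs.2 & ball c rs.1 q].
  have [|r r0 Hr] := ug n.+1%:R^-1; first by rewrite invr_gt0 ltr0n.
  have [s sC Hs] := compact_finite_net _ _ cC r0.
  by exists (r, s).
have [rs Hrs] := choice H.
apply: (measurability _ (RGenOInfty.measurableE R)) => //.
move=> /= _ [_ [a ->] <-]; rewrite setTI.
pose A n := [set c | c \in (rs n).2 /\ a + n.+1%:R^-1 < g c].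
rewrite [X in measurable X](_ : _ =
  \bigcup_n \bigcup_(c in A n) (F @^-1` ball c (rs n).1)); last first.
  apply/seteqP; split => [x|x [n _ [c [cs ac] bx]]] /=; rewrite in_itv /= andbT.
    rewrite -subr_gt0 => gx.
    (* The factor 2 pays for the oscillation of [g] and for the margin required of centres in
       [A n]. *)
    have [n Hn] : exists n : nat, n.+1%:R^-1 < (g (F x) - a) / 2.
      exists (Num.bound ((g (F x) - a) / 2)^-1).
      rewrite invf_plt ?posrE ?ltr0n ?divr_gt0 //.
      apply: (lt_trans (archi_boundP _)); rewrite ?ltr_nat // invr_ge0 ltW //.
      by rewrite divr_gt0.
    have [r0 osc sC net] := Hrs n.
    have [c cs bc] := net _ (CF x).
    exists n => //; exists c => //; split => //.
    have := osc _ _ (sC _ cs) (CF x) bc; rewrite ler_norml => /andP[h _].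
    by move: h Hn; set v := _^-1; lra.
  have [r0 osc sC net] := Hrs n.
  have := osc _ _ (sC _ cs) (CF x) bx; rewrite ler_norml => /andP[_ h].
  by move: h ac => /=; set v := _^-1; lra.
apply: bigcup_measurable => n _; apply: fin_bigcup_measurable => //.
by apply: (sub_finite_set _ (finite_seq (rs n).2)) => c [].
Qed.

(** Balls of row vectors are those of the sup norm, hence finite intersections of coordinate
    conditions. A nonpositive radius is treated apart: the ball is then empty, whereas for [D = 0]
    the intersection is the whole space. *)
Lemma measurable_vec_ball {R : realType} {D : nat} {dO : measure_display}
    {O : measurableType dO} (F : O -> 'rV[R]_D) (c : 'rV[R]_D) r :
  measurable_vec F -> measurable (F @^-1` ball c r).
Proof.
move=> mF; have [r0|r0] := ltP 0 r; last first.
  rewrite (_ : _ @^-1` _ = set0) //; apply/seteqP; split => x //= [].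
  by rewrite ltNge r0.
rewrite (_ : _ @^-1` _ =
    \bigcap_(j in [set: 'I_D]) ((fun x => F x ord0 j) @^-1` ball (c ord0 j) r)).
  apply: fin_bigcap_measurable => // j _.
  rewrite -[X in measurable X]setTI; apply: mF => //.
  exact: measurable_ball.
apply/seteqP; split => x /=.
  by move=> [_ H] j _; exact: H.
by move=> H; split => // i j; rewrite ord1; exact: H.
Qed.

Lemma unif_continuous_bounded {R : realType} {V : pseudoMetricType R}
    (C : set V) (g : V -> R) :
  compact C -> unif_continuous_on C g ->
  exists M : R, forall q, C q -> `|g q| <= M.
Proof.
move=> cC /(_ 1 ltr01)[r r0 Hr].
have [s sC net] := compact_finite_net _ _ cC r0.
(* The sum dominates the value at any centre of the net, and 1 is the oscillation allowed within its
   radius. *)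
exists (\sum_(c <- s) `|g c| + 1) => q Cq.
have [c cs bc] := net q Cq.
rewrite -(subrK (g c) (g q)) addrC (le_trans (ler_normD _ _)) //.
rewrite lerD //; last by rewrite distrC; exact: Hr (sC _ cs) Cq bc.
by rewrite (big_rem c) //= lerDl sumr_ge0.
Qed.

(** Measurability of [F] is asked on balls only, so the same statement serves maps into K and maps
    into K x K. *)
Lemma bounded_measurable_unif_continuous_comp {R : realType}
    {V : pseudoMetricType R} {dO : measure_display} {O : measurableType dO}
    (C : set V) (g : V -> R) (F : O -> V) :
  compact C -> unif_continuous_on C g -> (forall x, C (F x)) ->
  (forall c r, measurable (F @^-1` ball c r)) ->
  bounded_measurable (fun x => g (F x)).
Proof.
move=> cC ug CF mF; split; first exact: (measurable_unif_continuous_comp C g F).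
have [M HM] := unif_continuous_bounded _ _ cC ug.
by exists M => x; exact: HM.
Qed.

(** * Estimates for means, integrals and the logarithm *)

Lemma sample_mean_cst {R : realType} (c : R) n :
  sample_mean (fun=> c) n.+1 = c.
Proof.
by rewrite /sample_mean sumr_const card_ord -[c *+ _]mulr_natl mulKf ?pnatr_eq0.
Qed.

Lemma ler_sample_mean {R : realType} (y z : nat -> R) n :
  (forall i, y i <= z i) -> sample_mean y n <= sample_mean z n.
Proof.
by move=> yz; rewrite /sample_mean ler_wpM2l ?invr_ge0 // ler_sum.
Qed.

Lemma sample_mean_dist {R : realType} (y z : nat -> R) e n :
  (forall i, `|y i - z i| <= e) ->
  `|sample_mean y n - sample_mean z n| <= e.
Proof.
move=> yz; have e0 : 0 <= e by apply: le_trans (yz 0).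
case: n => [|n]; first by rewrite /sample_mean !big_ord0 !mulr0 subrr normr0.
rewrite -[leRHS](sample_mean_cst e n) /sample_mean -mulrBr -sumrB normrM.
rewrite ger0_norm ?invr_ge0 // ler_wpM2l ?invr_ge0 //.
by rewrite (le_trans (ler_norm_sum _ _ _)) // ler_sum.
Qed.

Lemma Rintegral_dist {dS : measure_display} {S : measurableType dS}
    {R : realType} (p : probability S R) (f g : S -> R) e :
  bounded_measurable f -> bounded_measurable g ->
  (forall x, `|f x - g x| <= e) -> `|\int[p]_x f x - \int[p]_x g x| <= e.
Proof.
move=> bf bg fg.
have If := bounded_measurable_integrable p _ bf.
have Ig := bounded_measurable_integrable p _ bg.
have Ie := bounded_measurable_integrable p _ (bounded_measurable_cst e).
rewrite ler_distl -[X in _ - X <= _](Rintegral_prob_cst p).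
rewrite -[X in _ && (_ <= _ + X)](Rintegral_prob_cst p).
rewrite -RintegralB // -RintegralD //.
have H x : g x - e <= f x <= g x + e by rewrite -ler_distl.
apply/andP; split; apply: le_Rintegral => //.
- by apply/bounded_measurable_integrable/bounded_measurableD => //;
    exact: bounded_measurable_cst.
- by move=> x _; have /andP[] := H x.
- by apply/bounded_measurable_integrable/bounded_measurableD => //;
    exact: bounded_measurable_cst.
- by move=> x _; have /andP[] := H x.
Qed.

(** For [y <= x], the difference is [ln (1 + (x - y) / y)], at most [(x - y) / y], and [m <= y]. *)
Lemma ln_lipschitz {R : realType} (m x y : R) :
  0 < m -> m <= x -> m <= y -> `|ln x - ln y| <= `|x - y| / m.
Proof.
move=> m0.
wlog yx : x y / y <= x.
  move=> H mx my; have [yx|/ltW xy] := leP y x; first exact: H.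
  by rewrite distrC (distrC x); exact: H.
move=> mx my.
have y0 : 0 < y by exact: lt_le_trans my.
have x0 : 0 < x by exact: lt_le_trans mx.
rewrite !ger0_norm ?subr_ge0 ?ler_ln ?posrE //.
rewrite -ln_div ?posrE // (_ : x / y = 1 + (x - y) / y); last first.
  by field; rewrite gt_eqF.
have xy0 : 0 <= (x - y) / y by rewrite divr_ge0 ?subr_ge0 // ltW.
rewrite (le_trans (le_ln1Dx _)) ?(lt_le_trans _ xy0) ?ltrN10 //.
by rewrite ler_wpM2l ?subr_ge0 // lef_pV2 // posrE.
Qed.

(** * Uniform strong law and the log-partition term *)

Section UniformLaw.
Context {dO dS : measure_display} {O : measurableType dO}
  {S : measurableType dS} {R : realType} {V : pseudoMetricType R}.
Variables (P : probability O R) (p : probability S R) (Z : nat -> O -> S).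
Hypothesis mZ : forall i, measurable_fun setT (Z i).
Hypothesis lawZ : forall i, has_law P (Z i) p.
Hypothesis indZ : mutually_independent P Z.
Variables (K : set V) (a b : S -> V) (k : V -> V -> R) (m : R).
Hypothesis cK : compact K.
Hypothesis aK : forall z, K (a z).
Hypothesis bK : forall z, K (b z).
Hypothesis ma : forall c r, measurable (a @^-1` ball c r).
Hypothesis mb : forall c r, measurable (b @^-1` ball c r).
Hypothesis kuc : forall e : R, 0 < e -> exists2 r : R, 0 < r &
  forall u u' v v', K u -> K u' -> K v -> K v' ->
  ball u r u' -> ball v r v' -> `|k u v - k u' v'| <= e.
Hypothesis m0 : 0 < m.
Hypothesis km : forall u v, K u -> K v -> m <= k u v.

Let G u := \int[p]_z k u (b z).

Let bk u : K u -> bounded_measurable (fun z => k u (b z)).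
Proof.
move=> Ku; apply: (bounded_measurable_unif_continuous_comp K (k u)) => //.
move=> e e0; have [r r0 Hr] := kuc _ e0; exists r => // v v' Kv Kv' vv'.
by apply: Hr => //; exact: ballxx.
Qed.

Let kuc1 e : 0 < e -> exists2 r, 0 < r &
  forall u u' v, K u -> K u' -> K v -> ball u r u' -> `|k u v - k u' v| <= e.
Proof.
move=> e0; have [r r0 Hr] := kuc _ e0; exists r => // u u' v Ku Ku' Kv uu'.
by apply: Hr => //; exact: ballxx.
Qed.

Let G_dist u u' e : K u -> K u' ->
  (forall v, K v -> `|k u v - k u' v| <= e) -> `|G u - G u'| <= e.
Proof. by move=> Ku Ku' H; apply: Rintegral_dist => *; [exact: bk..|exact: H]. Qed.

(** The null set is chosen before [e], through nets at the countably many scales [n.+1%:R^-1]. For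
    given [e], moving from [u] to a centre costs [e / 3] in the mean and in [G], and the law at the
    centre costs another [e / 3]. *)
Lemma strong_law_unif : {ae P, forall w, forall e, 0 < e ->
  \forall n \near \oo, forall u, K u ->
  `|sample_mean (fun j => k u (b (Z j w))) n - G u| <= e}.
Proof.
have H n : exists rs : R * seq V, [/\ 0 < rs.1,
    forall u u' v, K u -> K u' -> K v -> ball u rs.1 u' ->
      `|k u v - k u' v| <= n.+1%:R^-1,
    {in rs.2, forall c, K c} &
    forall q, K q -> exists2 c, c \in rs.2 & ball c rs.1 q].
  have [|r r0 Hr] := kuc1 n.+1%:R^-1; first by rewrite invr_gt0 ltr0n.
  have [s sC Hs] := compact_finite_net _ _ cK r0.
  by exists (r, s).
have [rs Hrs] := choice H.
(* A point of [K] serves as default value for [nth]; for empty [K] the claim is vacuous. *)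
have [[u0 Ku0]|K0] := pselect (exists u, K u); last first.
  by apply: aeW => w e e0; apply: nearW => n u Ku; case: K0; exists u.
pose c n i := nth u0 (rs n).2 i.
have : {ae P, forall w, forall n i, K (c n i) ->
    sample_mean (fun j => k (c n i) (b (Z j w))) @ \oo --> G (c n i)}.
  apply: ae_foralln => n; apply: ae_foralln => i.
  have [Kc|nKc] := pselect (K (c n i)); last by apply: aeW => w /nKc.
  have := strong_law_bounded _ _ _ mZ lawZ indZ _ (bk _ Kc).
  by apply: filterS => w Hw _.
apply: filterS => w Hw e e0.
have [n Hn] : exists n : nat, n.+1%:R^-1 <= e / 3.
  have e3 : 0 < e / 3 by rewrite divr_gt0.
  exists (Num.bound (e / 3)^-1).
  rewrite ltW // invf_plt ?posrE ?ltr0n //.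
  by apply: (lt_trans (archi_boundP _)); rewrite ?ltr_nat // invr_ge0 ltW.
have [r0 osc sK net] := Hrs n.
(* Finitely many centres share one threshold, by induction on how many are treated. *)
have near_net : \forall N \near \oo, forall i, (i < size (rs n).2)%N ->
    `|sample_mean (fun j => k (c n i) (b (Z j w))) N - G (c n i)| <= e / 3.
  suff Hs M : (M <= size (rs n).2)%N -> \forall N \near \oo, forall i, (i < M)%N ->
    `|sample_mean (fun j => k (c n i) (b (Z j w))) N - G (c n i)| <= e / 3.
    exact: Hs.
  elim: M => [_|M IH Ms]; first by apply: nearW.
  have := Hw n M (sK _ (mem_nth _ Ms)).
  move/cvgrPdist_le => /(_ _ (divr_gt0 e0 (ltr0Sn _ 2))).
  apply: filterS2 (IH (ltnW Ms)) => N h1 h2 i.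
  by rewrite ltnS leq_eqVlt => /orP[/eqP->|/h1//]; rewrite distrC.
apply: filterS near_net => N HN u Ku.
have [d ds bd] := net u Ku.
have := HN (index d (rs n).2); rewrite index_mem ds => /(_ isT).
rewrite /c nth_index // => Hd.
have Kd := sK d ds.
have A1 : `|sample_mean (fun j => k u (b (Z j w))) N -
            sample_mean (fun j => k d (b (Z j w))) N| <= e / 3.
  by apply: sample_mean_dist => j; rewrite distrC (le_trans (osc _ _ _ _ _ _ bd)).
have A2 : `|G d - G u| <= e / 3.
  by apply: G_dist => // v Kv; rewrite (le_trans (osc _ _ _ _ _ _ bd)).
rewrite (_ : _ - G u = (sample_mean (fun j => k u (b (Z j w))) N -
            sample_mean (fun j => k d (b (Z j w))) N) +
   (sample_mean (fun j => k d (b (Z j w))) N - G d) + (G d - G u)); last by ring.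
rewrite (le_trans (ler_normD _ _)) // (_ : e = e / 3 + e / 3 + e / 3); last by field.
rewrite lerD // (le_trans (ler_normD _ _)) // lerD //.
Qed.

Let G_ge u : K u -> m <= G u.
Proof.
move=> Ku; rewrite -(Rintegral_prob_cst p m); apply: le_Rintegral => //.
- exact/bounded_measurable_integrable/bounded_measurable_cst.
- exact/bounded_measurable_integrable/bk.
- by move=> z _; exact: km.
Qed.

Lemma strong_law_log_partition : {ae P, forall w,
  (fun n => sample_mean (fun i =>
     ln (sample_mean (fun j => k (a (Z i w)) (b (Z j w))) n)) n) @ \oo -->
  \int[p]_z ln (\int[p]_z' k (a z) (b z'))}.
Proof.
have bl : bounded_measurable (fun z => ln (G (a z))).
  apply: (bounded_measurable_unif_continuous_comp K (fun u => ln (G u))) => //.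
  (* The factor [m] offsets the Lipschitz constant [m^-1] of [ln] above [m]. *)
  move=> e e0; have [r r0 Hr] := kuc1 (e * m) (mulr_gt0 e0 m0).
  exists r => // u u' Ku Ku' uu'.
  rewrite (le_trans (ln_lipschitz m _ _ m0 _ _)) ?G_ge // ler_pdivrMr //.
  by apply: G_dist => // v Kv; exact: Hr.
have := strong_law_bounded _ _ _ mZ lawZ indZ _ bl.
apply: filterS2 strong_law_unif => w unif /cvgrPdist_le lln.
apply/cvgrPdist_le => e e0.
have e2 : 0 < e / 2 by rewrite divr_gt0.
(* An error [e / 2 * m] inside [ln] becomes [e / 2] outside. Positivity of [N] matters because the
   empty mean is 0, below [m]. *)
apply: filterS3 (unif _ (mulr_gt0 e2 m0)) (lln _ e2) (nbhs_infty_gt 0) => N HN HL N0.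
rewrite -(subrK (sample_mean (fun i => ln (G (a (Z i w)))) N) (\int[p]_z _)) -addrA.
rewrite (le_trans (ler_normD _ _)) // [leRHS](splitr e) lerD // distrC.
apply: sample_mean_dist => i.
have Am u : K u -> m <= sample_mean (fun j => k u (b (Z j w))) N.
  move=> Ku; case: N N0 {HN HL} => // N _.
  by rewrite -[leLHS](sample_mean_cst m N); apply: ler_sample_mean => j; exact: km.
rewrite (le_trans (ln_lipschitz m _ _ m0 _ _)) ?G_ge ?Am // ler_pdivrMr //.
exact: HN.
Qed.

End UniformLaw.

(** * Decomposition of the loss and its limit *)

Lemma half_loss_sample_mean {R : realType} (x : nat -> R) (s : nat -> nat -> R)
    (tau : R) (n : nat) : (forall i j, 0 < s i j) ->
  - n.+1%:R^-1 * \sum_(i < n.+1) ln (expR (- x i / tau) / \sum_(j < n.+1) s i j)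
    - ln n.+1%:R =
  sample_mean (fun i => x i / tau) n.+1
    + sample_mean (fun i => ln (sample_mean (s i) n.+1)) n.+1.
Proof.
(* Written as a mean of constants, [ln n.+1%:R] is absorbed termwise and turns each inner sum into
   an inner mean. *)
move=> s0; rewrite -[ln n.+1%:R](sample_mean_cst _ n) /sample_mean.
rewrite mulNr -mulrN -mulrBr -mulrDr -sumrN -sumrB -big_split /=; congr (_ * _).
apply: eq_bigr => i _.
have S0 : 0 < \sum_(j < n.+1) s i j.
  by rewrite big_ord_recl ltr_pwDl // sumr_ge0 // => j _; exact: ltW.
rewrite ln_div ?posrE ?expR_gt0 // expRK lnM ?posrE ?invr_gt0 ?ltr0n //.
by rewrite mulNr lnV ?posrE ?ltr0n //; ring.
Qed.

(** Expectations under a marginal are integrals against [p] of a function of one coordinate; the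
    separate variables [z] and [z'] express independent draws. *)
Theorem theorem3p1 (R : realType)
  (dO d1 d2 : measure_display) (Omega : measurableType dO) (P : probability Omega R)
  (X : measurableType d1) (T : measurableType d2)
  (p : probability (X * T)%type R)
  (Z : nat -> Omega -> (X * T)%type)
  (HZmeas : forall i, measurable_fun setT (Z i))
  (Hlaw : forall i, has_law P (Z i) p)
  (Hindep : mutually_independent P Z)
  (D : nat) (K : set 'rV[R]_D) (HK : compact K)
  (fx : X -> 'rV[R]_D) (ft : T -> 'rV[R]_D)
  (Hfx : measurable_vec fx) (Hft : measurable_vec ft)
  (HfxK : forall x, K (fx x)) (HftK : forall t, K (ft t))
  (d : 'rV[R]_D -> 'rV[R]_D -> R)
  (Hd : {within K `*` K, continuous (fun q : 'rV[R]_D * 'rV[R]_D => d q.1 q.2)})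
  (tau : R) (Htau : 0 < tau) :
  {ae P, forall w,
    (fun N : nat =>
       contrastive_loss d tau N (fun i => fx (Z i w).1) (fun i => ft (Z i w).2)
       - 2 * ln N%:R)
    @ \oo -->
    2 * (\int[p]_z (d (fx z.1) (ft z.2) / tau))
    + (\int[p]_z (ln (\int[p]_z' (expR (- d (fx z.1) (ft z'.2) / tau)))))
    + (\int[p]_z' (ln (\int[p]_z (expR (- d (fx z.1) (ft z'.2) / tau)))))}.
Proof.
have cKK : compact (K `*` K) by exact: compact_setX.
pose k u v := expR (- d u v / tau).
have k0 u v : 0 < k u v by exact: expR_gt0.
have ud : unif_continuous_on (K `*` K) (fun q => d q.1 q.2).
  exact: compact_unif_continuous.
have uk : unif_continuous_on (K `*` K) (fun q => k q.1 q.2).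
  apply: compact_unif_continuous => // q.
  apply: (@continuous_comp _ _ _ (fun q : subspace (K `*` K) => d q.1 q.2)
    (fun y => expR (- y / tau))); first exact: Hd.
  apply: (@continuous_comp _ _ _ (fun y : R => - y / tau) expR).
    by apply: cvgMr_tmp; apply: cvgN; exact: cvg_id.
  exact: continuous_expR.
have kuc (e : R) : 0 < e -> exists2 r : R, 0 < r &
    forall u u' v v', K u -> K u' -> K v -> K v' ->
    ball u r u' -> ball v r v' -> `|k u v - k u' v'| <= e.
  move=> /uk[r r0 Hr]; exists r => // u u' v v' Ku Ku' Kv Kv' uu' vv'.
  exact: (Hr (u, v) (u', v')).
have [B HB] := unif_continuous_bounded _ _ cKK ud.
(* The bound [B] of [d] on K x K supplies the positive lower bound of the kernel. *)
have km u v : K u -> K v -> expR (- B / tau) <= k u v.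
  move=> Ku Kv; rewrite ler_expR ler_pM2r ?invr_gt0 // lerN2.
  exact: le_trans (ler_norm _) (HB (u, v) (conj Ku Kv)).
have mx c r : measurable ((fun z : X * T => fx z.1) @^-1` ball c r).
  apply: measurable_vec_ball => j.
  exact: (measurableT_comp (Hfx j) measurable_fst).
have mt c r : measurable ((fun z : X * T => ft z.2) @^-1` ball c r).
  apply: measurable_vec_ball => j.
  exact: (measurableT_comp (Hft j) measurable_snd).
have bd : bounded_measurable (fun z : X * T => d (fx z.1) (ft z.2)).
  apply: (bounded_measurable_unif_continuous_comp (K `*` K) _
    (fun z : X * T => (fx z.1, ft z.2)) cKK ud) => [z|[c c'] r].
    exact: (conj (HfxK z.1) (HftK z.2)).
  (* A ball of the product space is the product of two balls of the same radius. *)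
  rewrite [X in measurable X](_ : _ = (fun z : X * T => fx z.1) @^-1` ball c r
    `&` (fun z : X * T => ft z.2) @^-1` ball c' r) //.
  exact: measurableI.
have bdt : bounded_measurable (fun z : X * T => d (fx z.1) (ft z.2) / tau).
  by apply: bounded_measurableM => //; exact: bounded_measurable_cst.
have lln1 := strong_law_bounded _ _ _ HZmeas Hlaw Hindep _ bdt.
have lln2 := strong_law_log_partition _ _ _ HZmeas Hlaw Hindep K
  (fun z => fx z.1) (fun z => ft z.2) k _ HK (fun z => HfxK z.1)
  (fun z => HftK z.2) mx mt kuc (expR_gt0 _) km.
(* The second half of the loss is the same law with the encoders exchanged and the kernel
   transposed. *)
have lln3 := strong_law_log_partition _ _ _ HZmeas Hlaw Hindep K
  (fun z => ft z.2) (fun z => fx z.1) (fun u v => k v u) _ HK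
  (fun z => HftK z.2) (fun z => HfxK z.1) mt mx
  (fun e e0 => let: ex_intro2 r r0 Hr := kuc e e0 in
    ex_intro2 _ _ r r0 (fun u u' v v' Ku Ku' Kv Kv' uu' vv' =>
      Hr v v' u u' Kv Kv' Ku Ku' vv' uu')) (expR_gt0 _)
  (fun u v Ku Kv => km v u Kv Ku).
apply: filterS3 lln1 lln2 lln3 => w c1 c2 c3.
apply: (cvg_trans _ (cvgD (cvgD (cvgM (cvg_cst (2 : R)) c1) c2) c3)).
apply: near_eq_cvg.
near=> N.
have N0 : (0 < N)%N by near: N; exact: nbhs_infty_gt.
rewrite -(prednK N0); move: N.-1 => n.
set u := fun i => fx (Z i w).1; set v := fun i => ft (Z i w).2.
have h1 := half_loss_sample_mean (fun i => d (u i) (v i))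
  (fun i j => k (u i) (v j)) tau n (fun i j => k0 _ _).
have h2 := half_loss_sample_mean (fun i => d (u i) (v i))
  (fun i j => k (u j) (v i)) tau n (fun i j => k0 _ _).
rewrite /contrastive_loss !fctE /=.
(* Each half of the loss takes one copy of the matched-pair mean and one of the two [ln] terms. *)
transitivity ((sample_mean (fun i => d (u i) (v i) / tau) n.+1 +
    sample_mean (fun i => ln (sample_mean (fun j => k (u i) (v j)) n.+1)) n.+1) +
  (sample_mean (fun i => d (u i) (v i) / tau) n.+1 +
    sample_mean (fun i => ln (sample_mean (fun j => k (u j) (v i)) n.+1)) n.+1)).
  by rewrite mulr_natl mulr2n -!addrA; congr (_ + _); rewrite addrCA.
by rewrite -h1 -h2 !mulNr addrACA -opprD -mulr2n mulr_natl mulNrn.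
Unshelve. all: end_near. Qed.
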